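(* Among the non-reduced marked elliptic root systems listed in the context, the following isomorphisms hold as root systems (linear isomorphisms of the ambient vector spaces carrying the first set of roots onto the second), for every rank $l$ for which both sides are defined. (1) Via the isomorphism $a\leftrightarrow b$: $R(BCC_l^{(2)}(1))\cong R(BB_l^{\vee(1)})$, $R(C^\vee BC_l^{(2)}(1))\cong R(BB_l^{\vee(4)})$, $R(BCC_l^{(2)}(2))\cong R(C^\vee C_l^{(1)})$, $R(C^\vee BC_l^{(2)}(2))\cong R(C^\vee C_l^{(4)})$, $R(BCC_l^{(2)\ast_p})\cong R(C^\vee C_l^{(1)\ast_p})$ and $R(C^\vee BC_l^{(2)\ast_p})\cong R(C^\vee C_l^{(4)\ast_p})$ for $p\in\{0,1\}$, and $R(BB_l^{\vee(2)}(2))\cong R(C^\vee C_l^{(2)}(1))$. (2) Via the isomorphism $a\mapsto a+b$, $b\mapsto b$: $R(BCC_l^{(1)\ast_{0'}})\cong R(BCC_l^{(1)\ast_0})$, $R(C^\vee BC_l^{(4)\ast_{0'}})\cong R(C^\vee BC_l^{(4)\ast_0})$, $R(C^\vee C_l^{(2)\ast_{1'}})\cong R(C^\vee C_l^{(2)\ast_1})$. (3) Via an exotic isomorphism and $a\leftrightarrow b$: $R(BCC_l^{(4)})\cong R(C^\vee BC_l^{(1)})\cong R(C^\vee C_l^{(2)\diamond})$.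
   Context: Let $F=\bigoplus_{i=1}^l\mathbb R\varepsilon_i\oplus\mathbb Rb\oplus\mathbb Ra$ with symmetric bilinear form $I$, $I(\varepsilon_i,\varepsilon_j)=\delta_{ij}$, $\mathrm{rad}(I)=\mathbb Ra\oplus\mathbb Rb$. The marking of each root system is $G=\mathbb Ra$; the isomorphisms are of root systems only and need not preserve the marking. The isomorphism $a\leftrightarrow b$ is the linear map with $\varepsilon_i\mapsto\varepsilon_i$, $a\mapsto b$, $b\mapsto a$. In (2) the map is specified only by its action on $\mathrm{rad}(I)$. In (3), the exotic isomorphism is the one, between $R(C^\vee BC_l^{(1)})$ and $R(C^\vee C_l^{(2)\diamond})$, obtained by replacing $a$ by $a+2b$ (with $b$ and the $\varepsilon_i$ kept). Put $B_s=\{\pm\varepsilon_i\}_{1\le i\le l}$, $B_m=\{\pm\varepsilon_i\pm\varepsilon_j\}_{1\le i<j\le l}$ (empty if $l=1$), $B_l=\{\pm2\varepsilon_i\}_{1\le i\le l}$, $\Lambda=\mathbb Za\oplus\mathbb Zb$. Each root system below is $R=(B_s+S)\cup(B_m+L)\cup(B_l+E)$ for a triple $(S,L,E)$ of subsets of $\Lambda$. Write $L_{i,j}=\{ma+nb:m,n\in\mathbb Z,\ (m-i)(n-j)\equiv0\bmod2\}$ and $L^{s_1,s_2}_{i,j}=\{s_2ma+s_1nb:m,n\in\mathbb Z,\ (m-i)(n-j)\equiv0\bmod2\}$. Unless stated otherwise $l\ge1$; $p\in\{0,1\}$. $BCC_l^{(1)\ast_0}$: $(\Lambda,\Lambda,L_{0,0})$;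 $BCC_l^{(1)\ast_{0'}}$: $(\Lambda,\Lambda,L_{0,1})$; $BCC_l^{(2)}(1)$ ($l\ge2$): $(\Lambda,\Lambda,2\mathbb Za+\mathbb Zb)$; $BCC_l^{(2)}(2)$: $(\Lambda,2\mathbb Za+\mathbb Zb,2\mathbb Za+\mathbb Zb)$; $BCC_l^{(2)\ast_p}$: $(\Lambda,2\mathbb Za+\mathbb Zb,L^{1,2}_{p,p})$; $BCC_l^{(4)}$: $(\Lambda,2\mathbb Za+\mathbb Zb,4\mathbb Za+\mathbb Zb)$. $C^\vee BC_l^{(1)}$: $(\Lambda,\mathbb Za+2\mathbb Zb,\mathbb Za+4\mathbb Zb)$; $C^\vee BC_l^{(2)}(1)$ ($l\ge2$): $(\Lambda,\mathbb Za+2\mathbb Zb,2\mathbb Za+4\mathbb Zb)$; $C^\vee BC_l^{(2)}(2)$: $(\Lambda,2\Lambda,2\mathbb Za+4\mathbb Zb)$; $C^\vee BC_l^{(2)\ast_p}$: $(L_{p,p},2\Lambda,2\mathbb Za+4\mathbb Zb)$; $C^\vee BC_l^{(4)\ast_0}$: $(L_{0,0},2\Lambda,4\Lambda)$; $C^\vee BC_l^{(4)\ast_{0'}}$: $(L_{0,1},2\Lambda,4\Lambda)$. $BB_l^{\vee(1)}$ ($l\ge2$): $(\Lambda,\Lambda,\mathbb Za+2\mathbb Zb)$; $BB_l^{\vee(2)}(2)$ ($l\ge2$): $(\Lambda,2\mathbb Za+\mathbb Zb,2\Lambda)$; $BB_l^{\vee(4)}$ ($l\ge2$): $(\Lambda,2\mathbb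 Za+\mathbb Zb,4\mathbb Za+2\mathbb Zb)$. $C^\vee C_l^{(1)}$: $(\Lambda,\mathbb Za+2\mathbb Zb,\mathbb Za+2\mathbb Zb)$; $C^\vee C_l^{(1)\ast_p}$: $(\Lambda,\mathbb Za+2\mathbb Zb,L^{2,1}_{p,p})$; $C^\vee C_l^{(2)}(1)$ ($l\ge2$): $(\Lambda,\mathbb Za+2\mathbb Zb,2\Lambda)$; $C^\vee C_l^{(2)\ast_1}$: $(L_{0,0},2\Lambda,L^{2,2}_{1,1})$; $C^\vee C_l^{(2)\ast_{1'}}$: $(L_{0,0},2\Lambda,L^{2,2}_{1,0})$; $C^\vee C_l^{(2)\diamond}$: $(\Lambda,\mathbb Za+2\mathbb Zb,\{ma+2nb:m,n\in\mathbb Z,\ m\equiv n\bmod2\})$; $C^\vee C_l^{(4)}$: $(\Lambda,2\Lambda,4\mathbb Za+2\mathbb Zb)$; $C^\vee C_l^{(4)\ast_p}$: $(L_{p,p},2\Lambda,4\mathbb Za+2\mathbb Zb)$. *)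

(* Defs.v *)
From mathcomp Require Import all_boot all_order all_algebra.
From mathcomp Require Import all_classical all_reals.
Set Implicit Arguments.
Unset Strict Implicit.
Unset Printing Implicit Defensive.
Import Order.TTheory GRing.Theory Num.Theory.
Local Open Scope classical_set_scope.
Local Open Scope ring_scope.

(* Coordinates on the ambient space: eps_1, ..., eps_l, then b, then a. *)
Definition eps {R : realType} {l : nat} (i : 'I_l) : 'rV[R]_(l + 2) :=
  delta_mx 0 (lshift 2 i).
Definition vec_b {R : realType} {l : nat} : 'rV[R]_(l + 2) :=
  delta_mx 0 (rshift l (ord0 : 'I_2)).
Definition vec_a {R : realType} {l : nat} : 'rV[R]_(l + 2) :=
  delta_mx 0 (rshift l (ord_max : 'I_2)).

Definition B_short {R : realType} {l : nat} : set 'rV[R]_(l + 2) :=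
  [set v | exists (i : 'I_l) (s : bool), v = (-1) ^+ s *: eps i].
Definition B_middle {R : realType} {l : nat} : set 'rV[R]_(l + 2) :=
  [set v | exists (i j : 'I_l) (s t : bool),
     (i < j)%N /\ v = (-1) ^+ s *: eps i + (-1) ^+ t *: eps j].
Definition B_long {R : realType} {l : nat} : set 'rV[R]_(l + 2) :=
  [set v | exists (i : 'I_l) (s : bool), v = (-1) ^+ s *: (2 *: eps i)].

(* Lambda_sub c d P = { c m a + d n b : m, n integers with P m n }. *)
Definition Lambda_sub {R : realType} {l : nat} (c d : int)
    (P : int -> int -> Prop) : set 'rV[R]_(l + 2) :=
  [set v | exists m n : int,
     P m n /\ v = (c * m)%:~R *: vec_a + (d * n)%:~R *: vec_b].

(* Z (c a) + Z (d b) *)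
Definition Lat {R : realType} {l : nat} (c d : int) : set 'rV[R]_(l + 2) :=
  Lambda_sub c d (fun _ _ => True).

(* L^{s1,s2}_{i,j}: the superscript s2 scales a and s1 scales b. *)
Definition Lpar {R : realType} {l : nat} (s1 s2 i j : int) :
    set 'rV[R]_(l + 2) :=
  Lambda_sub s2 s1 (fun m n => ((m - i) * (n - j) = 0 %[mod 2])%Z).

(* Here "Cv" and "Bv" stand for C^\vee and B^\vee.  In a name X_k_r, k is the
   upper index "(k)" and r the trailing "(r)"; X_k_st... is "(k) \ast_{...}",
   with a final "'" for a primed subscript; "_diam" is the diamond. *)
Inductive root_type : Type :=
| BCC_1_st0 | BCC_1_st0' | BCC_2_1 | BCC_2_2 | BCC_2_st of 'I_2 | BCC_4
| CvBC_1 | CvBC_2_1 | CvBC_2_2 | CvBC_2_st of 'I_2 | CvBC_4_st0 | CvBC_4_st0'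
| BBv_1 | BBv_2_2 | BBv_4
| CvC_1 | CvC_1_st of 'I_2 | CvC_2_1 | CvC_2_st1 | CvC_2_st1' | CvC_2_diam
| CvC_4 | CvC_4_st of 'I_2.

Definition min_rank (X : root_type) : nat :=
  match X with
  | BCC_2_1 | CvBC_2_1 | BBv_1 | BBv_2_2 | BBv_4 | CvC_2_1 => 2
  | _ => 1
  end.

(* The triple (S, L, E). *)
Definition root_data {R : realType} {l : nat} (X : root_type) :
    set 'rV[R]_(l + 2) * set 'rV[R]_(l + 2) * set 'rV[R]_(l + 2) :=
  match X with
  | BCC_1_st0   => (Lat 1 1, Lat 1 1, Lpar 1 1 0 0)
  | BCC_1_st0'  => (Lat 1 1, Lat 1 1, Lpar 1 1 0 1)
  | BCC_2_1     => (Lat 1 1, Lat 1 1, Lat 2 1)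
  | BCC_2_2     => (Lat 1 1, Lat 2 1, Lat 2 1)
  | BCC_2_st p  => (Lat 1 1, Lat 2 1, Lpar 1 2 p p)
  | BCC_4       => (Lat 1 1, Lat 2 1, Lat 4 1)
  | CvBC_1      => (Lat 1 1, Lat 1 2, Lat 1 4)
  | CvBC_2_1    => (Lat 1 1, Lat 1 2, Lat 2 4)
  | CvBC_2_2    => (Lat 1 1, Lat 2 2, Lat 2 4)
  | CvBC_2_st p => (Lpar 1 1 p p, Lat 2 2, Lat 2 4)
  | CvBC_4_st0  => (Lpar 1 1 0 0, Lat 2 2, Lat 4 4)
  | CvBC_4_st0' => (Lpar 1 1 0 1, Lat 2 2, Lat 4 4)
  | BBv_1       => (Lat 1 1, Lat 1 1, Lat 1 2)
  | BBv_2_2     => (Lat 1 1, Lat 2 1, Lat 2 2)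
  | BBv_4       => (Lat 1 1, Lat 2 1, Lat 4 2)
  | CvC_1       => (Lat 1 1, Lat 1 2, Lat 1 2)
  | CvC_1_st p  => (Lat 1 1, Lat 1 2, Lpar 2 1 p p)
  | CvC_2_1     => (Lat 1 1, Lat 1 2, Lat 2 2)
  | CvC_2_st1   => (Lpar 1 1 0 0, Lat 2 2, Lpar 2 2 1 1)
  | CvC_2_st1'  => (Lpar 1 1 0 0, Lat 2 2, Lpar 2 2 1 0)
  | CvC_2_diam  => (Lat 1 1, Lat 1 2,
                    Lambda_sub 1 2 (fun m n => (m = n %[mod 2])%Z))
  | CvC_4       => (Lat 1 1, Lat 2 2, Lat 4 2)
  | CvC_4_st p  => (Lpar 1 1 p p, Lat 2 2, Lat 4 2)
  end.

Definition roots {R : realType} {l : nat} (X : root_type) :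
    set 'rV[R]_(l + 2) :=
  let: (SS, LL, EE) := root_data X in
  [set u + v | u in B_short & v in SS] `|`
  [set u + v | u in B_middle & v in LL] `|`
  [set u + v | u in B_long & v in EE].

Definition swap_ab {R : realType} {l : nat}
    (phi : 'rV[R]_(l + 2) -> 'rV[R]_(l + 2)) : Prop :=
  [/\ forall i : 'I_l, phi (eps i) = eps i,
      phi vec_a = vec_b & phi vec_b = vec_a].

(* The images of the eps_i are deliberately left free: for
   C^\vee C_l^{(2)\ast_{1'}} the map fixing every eps_i does not work. *)
Definition shear_on_rad {R : realType} {l : nat}
    (phi : 'rV[R]_(l + 2) -> 'rV[R]_(l + 2)) : Prop :=
  phi vec_a = vec_a + vec_b /\ phi vec_b = vec_b.

Definition exotic {R : realType} {l : nat}
    (phi : 'rV[R]_(l + 2) -> 'rV[R]_(l + 2)) : Prop :=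
  [/\ forall i : 'I_l, phi (eps i) = eps i,
      phi vec_a = vec_a + 2 *: vec_b & phi vec_b = vec_b].

(* Whenever both systems are defined in rank l, some linear isomorphism
   satisfying "via" carries the first set of roots onto the second. *)
Definition root_iso {R : realType} {l : nat}
    (via : ('rV[R]_(l + 2) -> 'rV[R]_(l + 2)) -> Prop) (X Y : root_type) :
    Prop :=
  (min_rank X <= l)%N -> (min_rank Y <= l)%N ->
  exists phi : {linear 'rV[R]_(l + 2) -> 'rV[R]_(l + 2)},
    [/\ bijective phi, via phi & phi @` roots X = roots Y].

(* Main.v *)
Require Import Defs.
From mathcomp Require Import all_boot all_order all_algebra.
From mathcomp Require Import all_classical all_reals.
From mathcomp Require Import zify.

(** Every isomorphism is a linear map [phi] that sends each [eps i] to
    [eps i + t] for one fixed [t] in the radical, and acts on the radical by an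
    integral matrix.  For a finite root [u] the vector [phi u - u] then lies in
    the radical, so [phi (u + v) = u + ((phi u - u) + phi v)], and [phi] carries
    one root system onto another as soon as the affine maps
    [v |-> (phi u - u) + phi v] carry [S], [L], [E] onto their counterparts
    ([image_roots]).

    For [a <-> b] one takes [t = 0]; the lattice sets are exchanged by swapping
    the two coordinates ([image_swap_Lambda]).  The other maps have the form
    [a |-> a + q b], [b |-> b], [t = k b] with [q], [k] integers, and the
    conditions become congruences modulo [2] on coordinates
    ([image_transvection_Lambda]).  The exotic map has [q = 2], [k = 0]; the maps
    [a |-> a + b] have [q = 1], and [k = 0] in the first two cases.  For
    [C^\vee C_l^{(2)\ast_{1'}}] the shear moves [L_{0,0}] to [L_{0,1}] and fixes
    [L_{1,0}], and the translation by [t = b], which moves the short roots by [b]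
    and the long ones by [2b], corrects both: [L_{0,1} + b = L_{0,0}] and
    [2 L_{1,0} + 2 b = 2 L_{1,1}]. *)

Set Implicit Arguments.
Unset Strict Implicit.
Unset Printing Implicit Defensive.
Import Order.TTheory GRing.Theory Num.Theory.
Local Open Scope classical_set_scope.
Local Open Scope ring_scope.

(** * Linear maps given on the basis *)

(** The linear map with [eps i |-> eps i + t], [vec_a |-> a'] and
    [vec_b |-> b'], acting on row vectors by right multiplication; its matrix
    lists the images of the basis vectors as rows. *)
Definition frame_map {R : realType} {l : nat} (t a' b' : 'rV[R]_(l + 2)) :
    {linear 'rV[R]_(l + 2) -> 'rV[R]_(l + 2)} :=
  mulmxr (col_mx (\matrix_(i < l) (eps i + t))
                 (\matrix_(j < 2) (if j == ord0 then b' else a'))).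

Lemma frame_map_eps (R : realType) (l : nat) (t a' b' : 'rV[R]_(l + 2)) i :
  frame_map t a' b' (eps i) = eps i + t.
Proof. by rewrite /= /eps -rowE rowKu rowK. Qed.

Lemma frame_map_b (R : realType) (l : nat) (t a' b' : 'rV[R]_(l + 2)) :
  frame_map t a' b' vec_b = b'.
Proof. by rewrite /= /vec_b -rowE rowKd rowK. Qed.

Lemma frame_map_a (R : realType) (l : nat) (t a' b' : 'rV[R]_(l + 2)) :
  frame_map t a' b' vec_a = a'.
Proof. by rewrite /= /vec_a -rowE rowKd rowK. Qed.

Lemma linear_basis_id (R : realType) (l : nat)
    (phi : {linear 'rV[R]_(l + 2) -> 'rV[R]_(l + 2)}) :
  (forall i, phi (eps i) = eps i) -> phi vec_a = vec_a ->
  phi vec_b = vec_b -> phi =1 id.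
Proof.
move=> phie phia phib v; rewrite [v in LHS]row_sum_delta linear_sum /=.
rewrite [v in RHS]row_sum_delta; apply: eq_bigr => j _; rewrite linearZ /=.
congr (_ *: _); case: (splitP j) => k jk.
  by rewrite (_ : j = lshift 2 k); [exact: phie | exact: val_inj].
rewrite (_ : j = rshift l k); last exact: val_inj.
have [->|->] : k = ord0 \/ k = ord_max; [|exact: phib|exact: phia].
by case: k {jk} => [[|[|?]] ?] //; [left|right]; apply: val_inj.
Qed.

Lemma linear_basis_bij (R : realType) (l : nat)
    (phi psi : {linear 'rV[R]_(l + 2) -> 'rV[R]_(l + 2)}) :
  [/\ forall i, psi (phi (eps i)) = eps i, psi (phi vec_a) = vec_a &
      psi (phi vec_b) = vec_b] ->
  [/\ forall i, phi (psi (eps i)) = eps i, phi (psi vec_a) = vec_a &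
      phi (psi vec_b) = vec_b] ->
  bijective phi.
Proof.
move=> [h1 h2 h3] [k1 k2 k3]; exists psi => v.
  exact: (@linear_basis_id R l (psi \o phi)).
exact: (@linear_basis_id R l (phi \o psi)).
Qed.

(** The translations are the possible values of [phi u - u] for [u] short,
    middle and long. *)
Lemma image_roots (R : realType) (l : nat)
    (phi : {linear 'rV[R]_(l + 2) -> 'rV[R]_(l + 2)}) (t : 'rV[R]_(l + 2))
    (X Y : root_type) :
  (forall i, phi (eps i) = eps i + t) ->
  (forall s : bool, [set (-1) ^+ s *: t + phi v | v in (@root_data R l X).1.1]
     = (root_data Y).1.1) ->
  (forall s s' : bool,
     [set ((-1) ^+ s *: t + (-1) ^+ s' *: t) + phi v | v in (@root_data R l X).1.2]
     = (root_data Y).1.2) ->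
  (forall s : bool,
     [set (-1) ^+ s *: (2 *: t) + phi v | v in (@root_data R l X).2]
     = (root_data Y).2) ->
  phi @` Defs.roots X = Defs.roots Y.
Proof.
move=> phie; rewrite /Defs.roots.
case: (root_data X) => [[S L] E]; case: (root_data Y) => [[S' L'] E'] /=.
move=> hS hL hE; rewrite !image_setU.
have stratum (B A A' : set 'rV[R]_(l + 2)) :
    (forall u, B u -> exists2 z, phi u = u + z &
       [set z + phi v | v in A] = A') ->
    phi @` [set u + v | u in B & v in A] = [set u + v | u in B & v in A'].
  move=> hB; apply/seteqP; split.
    move=> _ [_ [u Bu [v Av <-]] <-]; have [z phiu <-] := hB u Bu.
    by exists u => //; exists (z + phi v); [exists v | rewrite linearD phiu addrA].
  move=> _ [u Bu [w A'w <-]]; have [z phiu hA] := hB u Bu.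
  move: A'w; rewrite -hA => -[v Av <-].
  exists (u + v); last by rewrite linearD phiu addrA.
  by exists u => //; exists v.
congr (_ `|` _ `|` _); apply: stratum => u.
- move=> [i [s ->]]; exists ((-1) ^+ s *: t) => //.
  by rewrite linearZ /= phie scalerDr.
- move=> [i [j [s [s' [_ ->]]]]]; exists ((-1) ^+ s *: t + (-1) ^+ s' *: t) => //.
  by rewrite linearD !linearZ /= !phie !scalerDr addrACA.
- move=> [i [s ->]]; exists ((-1) ^+ s *: (2 *: t)) => //.
  by rewrite !(linearZZ phi) phie !scalerDr.
Qed.

(** * The exchange of a and b *)

(** The map [a <-> b] fixing every [eps i]. *)
Definition swap_map {R : realType} {l : nat} :
    {linear 'rV[R]_(l + 2) -> 'rV[R]_(l + 2)} := frame_map 0 vec_b vec_a.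

Lemma swap_mapP (R : realType) (l : nat) : swap_ab (@swap_map R l).
Proof.
by split=> [i||]; rewrite ?frame_map_eps ?frame_map_a ?frame_map_b ?addr0.
Qed.

Lemma swap_map_bij (R : realType) (l : nat) : bijective (@swap_map R l).
Proof.
have [e a b] := swap_mapP R l.
by apply: (@linear_basis_bij R l _ swap_map); split=> [i||]; rewrite ?(e, a, b).
Qed.

Lemma image_swap_Lambda (R : realType) (l : nat) (c d : int)
    (P Q : int -> int -> Prop) :
  (forall m n, P m n <-> Q n m) ->
  swap_map @` @Lambda_sub R l c d P = Lambda_sub d c Q.
Proof.
move=> PQ; have [_ a b] := swap_mapP R l; apply/seteqP; split.
  move=> _ [_ [m [n [/PQ Qnm ->]]] <-]; exists n, m; split=> //.
  by rewrite linearD !(linearZZ swap_map) a b addrC.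
move=> _ [n [m [/PQ Pmn ->]]].
exists ((c * m)%:~R *: vec_a + (d * n)%:~R *: vec_b); first by exists m, n.
by rewrite linearD !(linearZZ swap_map) a b addrC.
Qed.

Lemma image_swap_Lat (R : realType) (l : nat) (c d : int) :
  swap_map @` @Lat R l c d = Lat d c.
Proof. exact: image_swap_Lambda. Qed.

Lemma image_swap_Lpar (R : realType) (l : nat) (s1 s2 i j : int) :
  swap_map @` @Lpar R l s1 s2 i j = Lpar s2 s1 j i.
Proof. by apply: image_swap_Lambda => m n; rewrite mulrC. Qed.

Lemma root_iso_swap (R : realType) (l : nat) (X Y : root_type) :
  swap_map @` (@root_data R l X).1.1 = (root_data Y).1.1 ->
  swap_map @` (@root_data R l X).1.2 = (root_data Y).1.2 ->
  swap_map @` (@root_data R l X).2 = (root_data Y).2 ->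
  root_iso (@swap_ab R l) X Y.
Proof.
move=> hS hL hE _ _; exists swap_map.
split; [exact: swap_map_bij | exact: swap_mapP |].
apply: (@image_roots R l _ 0) => [i|s|s s'|s].
- exact: frame_map_eps.
- by rewrite scaler0 -hS; apply: eq_imagel => v _; rewrite add0r.
- by rewrite !scaler0 -hL; apply: eq_imagel => v _; rewrite !add0r.
- by rewrite !scaler0 -hE; apply: eq_imagel => v _; rewrite add0r.
Qed.

(** * Transvections along b *)

(** [eps i |-> eps i + k b], [a |-> a + q b], [b |-> b]. *)
Definition transvection {R : realType} {l : nat} (k q : int) :
    {linear 'rV[R]_(l + 2) -> 'rV[R]_(l + 2)} :=
  frame_map (k%:~R *: vec_b) (vec_a + q%:~R *: vec_b) vec_b.

Lemma transvection_bij (R : realType) (l : nat) (k q : int) :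
  bijective (@transvection R l k q).
Proof.
have inv k1 q1 k2 q2 : k2 = - k1 -> q2 = - q1 ->
    [/\ forall i, transvection k1 q1 (transvection k2 q2 (eps i)) = @eps R l i,
        transvection k1 q1 (transvection k2 q2 vec_a) = @vec_a R l &
        transvection k1 q1 (transvection k2 q2 vec_b) = @vec_b R l].
  move=> -> ->; split=> [i||]; rewrite ?(frame_map_eps, frame_map_a, frame_map_b) //;
  by rewrite linearD (linearZZ (transvection k1 q1))
    ?(frame_map_eps, frame_map_a, frame_map_b) mulrNz scaleNr addrK.
by apply: (@linear_basis_bij R l _ (transvection (- k) (- q))); apply: inv;
  rewrite ?opprK.
Qed.

(** On the coefficients of [a] and [b] the map is [(x, y) |-> (x, z + q x + y)], so
    the scale [c] of [a] is unchanged while that of [b] may change from [d] to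
    [d']. *)
Lemma image_transvection_Lambda (R : realType) (l : nat) (k q z c d d' : int)
    (P P' : int -> int -> Prop) :
  (forall m n, P m n -> exists2 n', P' m n' & d' * n' = z + q * c * m + d * n) ->
  (forall m n', P' m n' -> exists2 n, P m n & d' * n' = z + q * c * m + d * n) ->
  [set z%:~R *: vec_b + transvection k q v | v in @Lambda_sub R l c d P]
    = Lambda_sub c d' P'.
Proof.
move=> h1 h2.
have E m n : z%:~R *: vec_b + @transvection R l k q
    ((c * m)%:~R *: vec_a + (d * n)%:~R *: vec_b) =
    (c * m)%:~R *: vec_a + (z + q * c * m + d * n)%:~R *: vec_b.
  rewrite linearD !(linearZZ (transvection k q)) frame_map_a frame_map_b scalerDr scalerA.
  rewrite addrCA -!addrA; congr (_ + _).
  rewrite -intrM -!scalerDl -!intrD; congr (_%:~R *: _); lia.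
apply/seteqP; split.
  move=> _ [_ [m [n [/h1[n' P'mn' e] ->]]] <-].
  by exists m, n'; split=> //; rewrite E e.
move=> _ [m [n' [/h2[n Pmn e] ->]]].
by exists ((c * m)%:~R *: vec_a + (d * n)%:~R *: vec_b);
  [exists m, n | rewrite E e].
Qed.

(** For [q = 1] and equal scales the translate and the shear combine into
    [(m, n) |-> (m, z + m + n)]. *)
Lemma image_shear_Lambda (R : realType) (l : nat) (k w z d : int)
    (P P' : int -> int -> Prop) :
  w = d * z -> (forall m n, P m n <-> P' m (z + m + n)) ->
  [set w%:~R *: vec_b + transvection k 1 v | v in @Lambda_sub R l d d P]
    = Lambda_sub d d P'.
Proof.
move=> -> PP'; apply: image_transvection_Lambda => m n h.
  by exists (z + m + n); [exact/PP' | rewrite mul1r !mulrDr].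
exists (n - z - m); last lia.
by apply/PP'; rewrite (_ : z + m + (n - z - m) = n) //; lia.
Qed.

(** [image_roots] for [t = k b], with the translations written as integral
    multiples of [b]. *)
Lemma image_roots_transvection (R : realType) (l : nat) (k q : int)
    (X Y : root_type) :
  (forall s : bool,
    [set ((-1) ^+ s * k)%:~R *: vec_b + transvection k q v
       | v in (@root_data R l X).1.1] = (root_data Y).1.1) ->
  (forall s s' : bool,
    [set ((-1) ^+ s * k + (-1) ^+ s' * k)%:~R *: vec_b + transvection k q v
       | v in (@root_data R l X).1.2] = (root_data Y).1.2) ->
  (forall s : bool,
    [set ((-1) ^+ s * (2 * k))%:~R *: vec_b + transvection k q v
       | v in (@root_data R l X).2] = (root_data Y).2) ->
  @transvection R l k q @` Defs.roots X = Defs.roots Y.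
Proof.
have sgn (s : bool) (x : int) :
    ((-1) ^+ s * x)%:~R *: @vec_b R l = (-1) ^+ s *: (x%:~R *: vec_b).
  by rewrite scalerA intrM rmorphXn.
move=> hS hL hE; apply: (@image_roots R l _ (k%:~R *: vec_b)) => [i|s|s s'|s].
- exact: frame_map_eps.
- by rewrite -(hS s) sgn.
- by rewrite -(hL s s') intrD scalerDl !sgn.
- by rewrite -(hE s) sgn intrM -scalerA.
Qed.

(** * The isomorphisms *)

(** Turns the congruences defining [Lpar] into parity conditions, which are
    linear in [m] and [n]. *)
Lemma mulz_mod2 (x y : int) :
  (x * y = 0 %[mod 2])%Z <-> (2 %| x)%Z || (2 %| y)%Z.
Proof.
rewrite mod0z !dvdzE -Euclid_dvdM // -abszM -dvdzE.
by split=> [/dvdz_mod0P|/dvdz_mod0P].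
Qed.

Theorem theorem6p2 (R : realType) (l : nat) :
  [/\ [/\ root_iso (@swap_ab R l) BCC_2_1 BBv_1,
          root_iso (@swap_ab R l) CvBC_2_1 BBv_4,
          root_iso (@swap_ab R l) BCC_2_2 CvC_1 &
          root_iso (@swap_ab R l) CvBC_2_2 CvC_4],
      (forall p : 'I_2, root_iso (@swap_ab R l) (BCC_2_st p) (CvC_1_st p)),
      (forall p : 'I_2, root_iso (@swap_ab R l) (CvBC_2_st p) (CvC_4_st p)) &
      root_iso (@swap_ab R l) BBv_2_2 CvC_2_1]
  /\
  [/\ root_iso (@shear_on_rad R l) BCC_1_st0' BCC_1_st0,
      root_iso (@shear_on_rad R l) CvBC_4_st0' CvBC_4_st0 &
      root_iso (@shear_on_rad R l) CvC_2_st1' CvC_2_st1]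
  /\
  (root_iso (@swap_ab R l) BCC_4 CvBC_1 /\
   root_iso (@exotic R l) CvBC_1 CvC_2_diam).
Proof.
have shear k : shear_on_rad (@transvection R l k 1).
  by split; rewrite ?frame_map_a ?frame_map_b // scale1r.
split; last split.
- by split; [split | move=> p | move=> p |]; apply: root_iso_swap;
    (exact: image_swap_Lat || exact: image_swap_Lpar).
- split=> _ _; [exists (transvection 0 1) | exists (transvection 0 1)
    | exists (transvection 1 1)];
  (split; [exact: transvection_bij | exact: shear |]);
  apply: image_roots_transvection => [s|s s'|s]; rewrite ?mulr0 ?addr0 ?mulr1.
  (* Three goals, for [S], [L] and [E], for each of the three isomorphisms. *)
  + exact: (@image_shear_Lambda _ _ _ _ 0).
  + exact: (@image_shear_Lambda _ _ _ _ 0).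
  + by apply: (@image_shear_Lambda _ _ _ _ 0) => // m n; rewrite !mulz_mod2; lia.
  + by apply: (@image_shear_Lambda _ _ _ _ 0) => // m n; rewrite !mulz_mod2; lia.
  + exact: (@image_shear_Lambda _ _ _ _ 0).
  + exact: (@image_shear_Lambda _ _ _ _ 0).
  + apply: (@image_shear_Lambda _ _ _ _ ((-1) ^+ s)); first by rewrite mul1r.
    by move=> m n; rewrite !mulz_mod2; case: s; rewrite ?expr0 ?expr1; lia.
  (* [(-1) ^+ s + (-1) ^+ s' = 2 (1 - s - s')] for bits [s], [s']. *)
  + by apply: (@image_shear_Lambda _ _ _ _ (1 - s%:Z - s'%:Z)) => //;
      case: s; case: s'.
  + apply: (@image_shear_Lambda _ _ _ _ ((-1) ^+ s)); first by rewrite mulrC.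
    by move=> m n; rewrite !mulz_mod2; case: s; rewrite ?expr0 ?expr1; lia.
- split.
    by apply: root_iso_swap; exact: image_swap_Lat.
  move=> _ _; exists (transvection 0 2); split; first exact: transvection_bij.
    split=> [i||]; rewrite ?(frame_map_eps, frame_map_a, frame_map_b) //.
    by rewrite scale0r addr0.
  apply: image_roots_transvection => [s|s s'|s]; rewrite ?mulr0 ?addr0;
    apply: image_transvection_Lambda => m n h.
  + by exists (2 * m + n); lia.
  + by exists (n - 2 * m); lia.
  + by exists (m + n); lia.
  + by exists (n - m); lia.
  + by exists (m + 2 * n); lia.
  (* The congruence between [m] and [n] modulo [2] makes the quotient exact. *)
  + by exists ((n - m) %/ 2)%Z; lia.
Qed.
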